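(* Fix a uniformity parameter $3\le t\le O(1)$, an arity $k\le O(1)$, a number $U=O(\sqrt n)$, a failure probability $0<p<1/2$, a parameter $0<\zeta\le 1/2$, and a parameter $1\le \mathrm{SMALL}\le n$. Form a random factor graph with $n$ variable-vertices and a set $\mathcal{C}$ of $\Delta n$ constraint-vertices of arity $k$, each constraint-vertex having as neighborhood an independent uniformly random ordered $k$-tuple of distinct variable-vertices and being equipped with a $(t-1)$-wise uniform distribution. Add two sets $\mathcal{M}_1,\mathcal{M}_2$ of nonrandom, pairwise non-overlapping constraints whose associated variable-vertices partition $[n]$: the constraints of $\mathcal{M}_1$ are unary, $|\mathcal{M}_1|\le U$, and carry a $0$-wise uniform distribution; the constraints of $\mathcal{M}_2$ have constant arity and carry a $1$-wise uniform distribution. Let $\zeta'=(k+1)\zeta$. If $\Delta\le c\cdot p\cdot (n/\mathrm{SMALL})^{\frac t2-1-\zeta'}$ for a sufficiently small universal constant $c>0$, then except with probability at most $p$ the following expansion condition holds: for every nonempty constraint-induced subgraph $H$ with $c(H)\le \mathrm{SMALL}$, $$v(H)\ge e(H)-\frac{T(H)}{2}+\zeta\, c(H).$$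
   Context: A factor graph is a bipartite graph between variable-vertices and constraint-vertices, each constraint-vertex $h$ being joined to the (ordered) tuple of variables in its scope. Each constraint $h$ carries a distribution that is $(t_h-1)$-wise uniform (a distribution on $\Omega^{k}$ is $s$-wise uniform if all its $s$-coordinate marginals are uniform; $0$-wise uniform means no condition); here $t_h=t$ for $h\in\mathcal{C}$, $t_h=1$ for $h\in\mathcal{M}_1$, $t_h=2$ for $h\in\mathcal{M}_2$. A constraint-induced subgraph $H$ is obtained by choosing a set of constraint-vertices together with all their incident edges and neighboring variable-vertices. $c(H)$ is the number of constraint-vertices of $H$, $e(H)$ its number of edges, $v(H)$ its number of variable-vertices, and $T(H)=\sum_{h\in H}t_h$.
   Formalization: The formal theorem additionally assumes ζ' = (k+1)ζ ≤ t/2 − 1, i.e. that the exponent in the bound on Δ is nonnegative; without this the claim fails (e.g. t = k = 3, ζ = 1/2, SMALL = n, M_2 consisting of disjoint pairs). *)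

(* Defs.v *)
From HB Require Import structures.
From mathcomp Require Import all_boot all_order all_algebra.
From mathcomp Require Import reals exp.

Set Implicit Arguments.
Unset Strict Implicit.
Unset Printing Implicit Defensive.

Import Order.TTheory GRing.Theory Num.Theory.
Local Open Scope ring_scope.

Record fdist (R : realType) (T : finType) := FDist {
  pmf :> T -> R;
  pmf_ge0 : forall x, 0 <= pmf x;
  pmf_sum1 : \sum_x pmf x = 1 }.

Definition marginal (R : realType) (Omega : finType) (k : nat)
    (mu : fdist R (k.-tuple Omega)) (S : {set 'I_k})
    (y : {ffun {i | i \in S} -> Omega}) : R :=
  \sum_(x : k.-tuple Omega | [forall i, tnth x (val i) == y i]) mu x.

Definition wise_uniform (R : realType) (Omega : finType) (s k : nat)
    (mu : fdist R (k.-tuple Omega)) : Prop :=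
  forall S : {set 'I_k}, #|S| = s ->
  forall y : {ffun {i | i \in S} -> Omega},
    marginal mu y = #|{ffun {i | i \in S} -> Omega}|%:R^-1.

(* Ordered k-tuples of distinct variable-vertices. *)
Definition scope_tuple (k n : nat) : finType := {x : k.-tuple 'I_n | uniq x}.

(* The variable-vertices are 'I_n; [uparam h] is the label t_h. *)
Record factor_graph (R : realType) (Omega : finType) (n : nat) := FactorGraph {
  cvert : finType;
  arity : cvert -> nat;
  scope : forall h, scope_tuple (arity h) n;
  uparam : cvert -> nat;
  cdist : forall h, fdist R ((arity h).-tuple Omega);
  cdist_uniform : forall h, wise_uniform (uparam h).-1 (cdist h) }.

Arguments cvert {R Omega n}.
Arguments arity {R Omega n} f h.
Arguments scope {R Omega n} f h.
Arguments uparam {R Omega n} f h.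
Arguments cdist {R Omega n} f h.

Section Subgraphs.
Variables (R : realType) (Omega : finType) (n : nat).
Variable G : factor_graph R Omega n.

Definition vars_of (h : cvert G) : {set 'I_n} := [set v in val (scope G h)].

(* A constraint-induced subgraph is determined by, and represented by, its set
   H of constraint-vertices. *)
Definition sub_edges (H : {set cvert G}) : {set cvert G * 'I_n} :=
  [set hv | (hv.1 \in H) && (hv.2 \in vars_of hv.1)].

Definition sub_vars (H : {set cvert G}) : {set 'I_n} :=
  \bigcup_(h in H) vars_of h.

Definition c_count (H : {set cvert G}) : nat := #|H|.
Definition e_count (H : {set cvert G}) : nat := #|sub_edges H|.
Definition v_count (H : {set cvert G}) : nat := #|sub_vars H|.
Definition T_total (H : {set cvert G}) : nat := (\sum_(h in H) uparam G h)%N.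

Definition expansion (zeta small : R) : bool :=
  [forall H : {set cvert G},
     (H != set0) ==> ((c_count H)%:R <= small) ==>
     ((v_count H)%:R >=
        (e_count H)%:R - (T_total H)%:R / 2 + zeta * (c_count H)%:R)].

Definition partitions_vars : Prop :=
  (forall h h' : cvert G, h != h' -> [disjoint vars_of h & vars_of h'])
  /\ \bigcup_(h : cvert G) vars_of h = [set: 'I_n].

End Subgraphs.

Section Union.
Variables (R : realType) (Omega : finType) (n : nat).
Variables G1 G2 : factor_graph R Omega n.

Definition union_arity (h : cvert G1 + cvert G2) : nat :=
  match h with inl h1 => arity G1 h1 | inr h2 => arity G2 h2 end.

Definition union_scope (h : cvert G1 + cvert G2) :
    scope_tuple (union_arity h) n :=
  match h with inl h1 => scope G1 h1 | inr h2 => scope G2 h2 end.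

Definition union_uparam (h : cvert G1 + cvert G2) : nat :=
  match h with inl h1 => uparam G1 h1 | inr h2 => uparam G2 h2 end.

Definition union_cdist (h : cvert G1 + cvert G2) :
    fdist R ((union_arity h).-tuple Omega) :=
  match h with inl h1 => cdist G1 h1 | inr h2 => cdist G2 h2 end.

Lemma union_cdist_uniform h :
  wise_uniform (union_uparam h).-1 (union_cdist h).
Proof. by case: h => h; apply: cdist_uniform. Qed.

(* Same variable-vertices, disjoint union of the constraint-vertices. *)
Definition fg_union : factor_graph R Omega n :=
  @FactorGraph R Omega n (cvert G1 + cvert G2)%type
    union_arity union_scope union_uparam union_cdist union_cdist_uniform.

End Union.

(* The graph with m constraints of arity k and label t whose neighbourhoods are
   given by the outcome w. *)
Definition outcome_graph (R : realType) (Omega : finType) (n k t m : nat)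
    (mu : 'I_m -> fdist R (k.-tuple Omega))
    (mu_uniform : forall i, wise_uniform t.-1 (mu i))
    (w : {ffun 'I_m -> scope_tuple k n}) : factor_graph R Omega n :=
  @FactorGraph R Omega n 'I_m (fun=> k) (fun i => w i) (fun=> t) mu mu_uniform.

(* The probability of E when w 0, ..., w (m-1) are independent uniformly random
   ordered k-tuples of distinct elements of 'I_n; it is a probability measure
   only if such tuples exist (k <= n) or m = 0. *)
Definition prob_scopes (R : realType) (n k m : nat)
    (E : pred {ffun 'I_m -> scope_tuple k n}) : R :=
  \sum_(w | E w) \prod_(i < m) #|scope_tuple k n|%:R^-1.

(* Main.v *)
(** Let J be the random constraints of a non-expanding subgraph and K its
    nonrandom ones. Discard from K the constraints that do not meet the slots
    (the k |J| tuple entries) of J; at most k |J| remain, which turns zeta into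
    zeta' = (k+1) zeta. Label each slot by its constraint if that lies in K, and
    by its own vertex otherwise. Charging 1 for a vertex and t_h / 2 for a
    constraint, the distinct labels cost at most (k - t/2 + zeta') |J|.

    Put q = |J| / n. Slot sequences of low cost are counted by weighting each
    with q^cost: when labels are appended one at a time, an old label has
    O(|J|) occurrences and a new one contributes
    n q + |M_1| sqrt q + n q = O(|J|), so the total weight is at most
    (O(|J|))^(k |J|). Here |M_1| = O(sqrt n) is what makes unary constraints
    affordable. Hence a given J is bad with probability at most
    (O(1) q^(t/2 - zeta'))^|J|, and the union over J costs
    C(m, j) <= (e m / j)^j, leaving a geometric series. *)
Require Import Defs.
From mathcomp Require Import all_boot all_order all_algebra.
From mathcomp Require Import reals sequences exp.
From mathcomp Require Import ring lra.

Set Implicit Arguments.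
Unset Strict Implicit.
Unset Printing Implicit Defensive.

Import Order.TTheory GRing.Theory Num.Theory.
Local Open Scope ring_scope.

(** * Counting sequences by the cost of their distinct labels *)

Definition label_cost (T : Type) (L : eqType) (lab : T -> L) (c : L -> nat)
    (s : seq T) : nat := (\sum_(l <- undup (map lab s)) c l)%N.

Lemma big_tuple_cons (V : nmodType) (T : finType) (N : nat) (F : seq T -> V) :
  \sum_(s : N.+1.-tuple T) F s = \sum_(s : N.-tuple T) \sum_x F (x :: s).
Proof.
rewrite pair_bigA /=.
rewrite (reindex (fun p : N.-tuple T * T => [tuple of p.2 :: p.1])) //=.
exists (fun s : N.+1.-tuple T => ([tuple of behead s], thead s)).
  by move=> [s x] _; congr pair; apply: val_inj.
by move=> s _; rewrite [RHS]tuple_eta.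
Qed.

Lemma card_label_in (T : finType) (L : eqType) (lab : T -> L) (A : nat)
    (l : seq L) :
  (forall a, #|[pred x | lab x == a]| <= A)%N ->
  (#|[pred x | lab x \in l]| <= A * size l)%N.
Proof.
move=> fib; elim: l => [|a l IH] /=; first by rewrite muln0 leqn0 eq_card0.
rewrite mulnS; apply: leq_trans (leq_add (fib a) IH).
rewrite -cardUI; apply: leq_trans (leq_addr _ _).
by apply: subset_leq_card; apply/subsetP => x; rewrite !inE.
Qed.

(* A new entry of the sequence either repeats one of at most N0 labels, which
   is free of charge, or pays for its own label. *)
Lemma sum_label_cost (R : realType) (T : finType) (L : eqType) (lab : T -> L)
    (c : L -> nat) (r : R) (A N N0 : nat) :
  0 <= r -> (forall a, #|[pred x | lab x == a]| <= A)%N -> (N <= N0)%N ->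
  \sum_(s : N.-tuple T) r ^+ label_cost lab c s
    <= ((A * N0)%:R + \sum_x r ^+ c (lab x)) ^+ N.
Proof.
move=> r0 fib; set B := _ + _.
have B0 : 0 <= B by rewrite addr_ge0 ?sumr_ge0 // => x _; rewrite exprn_ge0.
elim: N => [|N IH] leN.
  rewrite expr0 (big_pred1 [tuple]) => [|s]; last by rewrite [s]tuple0 /= eqxx.
  by rewrite /label_cost big_nil expr0.
rewrite (big_tuple_cons N (fun s => r ^+ label_cost lab c s)) exprSr.
apply: le_trans (_ : _ <= \sum_(s : N.-tuple T) r ^+ label_cost lab c s * B) _.
  apply: ler_sum => s _.
  apply: le_trans (_ : _ <= \sum_x ((lab x \in map lab s)%:R
     * r ^+ label_cost lab c s + r ^+ label_cost lab c s * r ^+ c (lab x))) _.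
    apply: ler_sum => x _; rewrite /label_cost /=.
    case: ifP => _; first by rewrite mul1r lerDl mulr_ge0 ?exprn_ge0.
    by rewrite big_cons exprD mulrC mul0r add0r.
  rewrite big_split /= -mulr_suml -mulr_sumr [X in X + _]mulrC -mulrDr.
  rewrite ler_wpM2l ?exprn_ge0 // lerD2r -natr_sum ler_nat -big_mkcond sum1_card.
  apply: leq_trans (card_label_in (map lab s) fib) _.
  by rewrite size_map size_tuple leq_mul2l ltnW ?orbT.
by rewrite -mulr_suml ler_wpM2r // IH // ltnW.
Qed.

(** A Markov-type bound: as [r <= 1], every sequence of cost at most [x] has weight at least [r^x]
    in the total weight. *)
Lemma card_low_cost (R : realType) (T : finType) (L : eqType) (lab : T -> L)
    (c : L -> nat) (r x : R) (A N : nat) :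
  0 < r <= 1 -> (forall a, #|[pred x | lab x == a]| <= A)%N ->
  #|[set s : N.-tuple T | (label_cost lab c s)%:R <= x]|%:R * r `^ x
    <= ((A * N)%:R + \sum_x r ^+ c (lab x)) ^+ N.
Proof.
move=> /andP[r0 r1] fib.
apply: le_trans (sum_label_cost c (ltW r0) fib (leqnn N)).
rewrite -sum1_card natr_sum mulr_suml [leRHS](bigID (mem
  [set s : N.-tuple T | (label_cost lab c s)%:R <= x])) /=.
apply: ler_wpDr; first by apply: sumr_ge0 => s _; rewrite exprn_ge0 // ltW.
apply: ler_sum => s; rewrite inE mul1r => le_x.
by rewrite -powR_mulrn ?(ltW r0) //; apply: ger_powR; rewrite ?r0.
Qed.

(** * Numerical estimates *)

(** One term of the binomial expansion of [(1 + x)^m] is at most the whole, hence at most [e^(x m)];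
    take [x = j / m]. *)
Lemma bin_mul_le (R : realType) (m j : nat) :
  'C(m, j)%:R * j%:R ^+ j <= (expR 1 * m%:R) ^+ j :> R.
Proof.
case: (ltnP m j) => [lt|le]; first by rewrite bin_small // mul0r exprn_ge0 //
  mulr_ge0 ?expR_ge0.
case: m le => [|m] le; first by rewrite leqn0 in le; rewrite (eqP le) bin0 mulr1.
set x : R := j%:R / m.+1%:R.
have x0 : 0 <= x by rewrite divr_ge0.
have : 'C(m.+1, j)%:R * x ^+ j <= expR 1 ^+ j.
  apply: le_trans (_ : (1 + x) ^+ m.+1 <= _).
    have jm : (j < m.+2)%N by [].
    rewrite exprDn (bigD1 (Ordinal jm)) //= expr1n mul1r mulr_natl lerDl.
    by apply: sumr_ge0 => i _; rewrite mulrn_wge0 // mulr_ge0 // exprn_ge0.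
  apply: (@le_trans _ _ (expR x ^+ m.+1)).
    by rewrite lerXn2r ?nnegrE ?expR_ge0 ?addr_ge0 ?expR_ge1Dx.
  by rewrite -!expRM_natr mul1r divfK ?pnatr_eq0.
rewrite exprMn exprVn mulrA ler_pdivrMr ?exprn_gt0 ?ltr0n //.
by rewrite -exprMn.
Qed.

Lemma sum_geometric_le (R : realType) (y : R) (m : nat) :
  0 <= y <= 1 / 2 -> \sum_(1 <= j < m.+1) y ^+ j <= 2 * y.
Proof.
move=> /andP[y0 y1].
(* The subtracted tail makes the induction close; its step is [2 y^(m+2) <= y^(m+1)]. *)
suff: \sum_(1 <= j < m.+1) y ^+ j <= 2 * y - 2 * y ^+ m.+1.
  by move/le_trans; apply; rewrite gerBl mulr_ge0 ?exprn_ge0.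
elim: m => [|m IH]; first by rewrite big_geq // expr1 subrr.
rewrite big_nat_recr //=; apply: le_trans (lerD IH (lexx _)) _.
rewrite [y ^+ m.+2]exprS.
have : 0 <= y ^+ m.+1 by rewrite exprn_ge0.
by nra.
Qed.

Lemma card_scope_tuple (k n : nat) : #|scope_tuple k n| = (n ^_ k)%N.
Proof.
rewrite card_sub -[n in RHS]card_ord -[RHS]card_uniq_tuples.
by rewrite -cardsE; apply: eq_card => x; rewrite !inE all_predT.
Qed.

(** Factor by factor, [n <= (i + 1) (n - i) <= k (n - i)] for [i < k]. *)
Lemma expn_le_ffact (k n : nat) : (k <= n)%N -> (n ^ k <= k ^ k * n ^_ k)%N.
Proof.
move=> kn; rewrite ffact_prod -[k in (n ^ k)%N]card_ord -[k in (_ ^ k * _)%N]card_ord.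
rewrite -!prod_nat_const -big_split /=; apply: leq_prod => i _.
have ik := ltn_ord i; have i_n : (i < n)%N := leq_trans ik kn.
apply: leq_trans (_ : i.+1 * (n - i) <= _)%N; last by rewrite leq_mul2r ik orbT.
by rewrite mulSn -[X in (X <= _)%N](subnK (ltnW i_n)) leq_add2l leq_pmulr ?subn_gt0.
Qed.

(** * Slots, labels and owners *)

Definition slots (n k m : nat) (w : {ffun 'I_m -> scope_tuple k n})
  (J : {set 'I_m}) : seq 'I_n := flatten [seq val (val (w i)) | i <- enum J].

Lemma size_slots (n k m : nat) (w : {ffun 'I_m -> scope_tuple k n})
  (J : {set 'I_m}) : size (slots w J) = (#|J| * k)%N.
Proof.
rewrite size_flatten /shape -map_comp cardE.
elim: (enum J) => //= i s ->.
by rewrite size_tuple mulSn.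
Qed.

(** The boolean records whether the owner of the vertex lies in the chosen set of nonrandom
    constraints. The label thus depends on the marked entry alone, not on that set. *)
Definition vertex_label (n : nat) (I : finType) (owner : 'I_n -> I)
  (p : bool * 'I_n) : 'I_n + I := if p.1 then inr (owner p.2) else inl p.2.

(* Costs are counted in half units, so that they are integers. *)
Definition half_cost (R : realType) (Omega : finType) (n : nat)
    (M : factor_graph R Omega n) (l : 'I_n + cvert M) : nat :=
  match l with inl _ => 2 | inr h => uparam M h end.

Lemma card_vars_of (R : realType) (Omega : finType) (n : nat)
  (G : factor_graph R Omega n) (h : cvert G) : #|vars_of h| = arity G h.
Proof. by rewrite cardsE (card_uniqP (valP (scope G h))) size_tuple. Qed.

Lemma e_countE (R : realType) (Omega : finType) (n : nat)
  (G : factor_graph R Omega n) (H : {set cvert G}) :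
  e_count H = (\sum_(h in H) arity G h)%N.
Proof.
rewrite /e_count -sum1_card.
under [RHS]eq_bigr do rewrite -card_vars_of -sum1_card.
by rewrite pair_big_dep /=; apply: eq_bigl => p; rewrite inE.
Qed.

Lemma owner_exists (R : realType) (Omega : finType) (n : nat)
    (M : factor_graph R Omega n) :
  partitions_vars M -> exists owner : 'I_n -> cvert M,
    forall x h, (x \in vars_of h) = (owner x == h).
Proof.
move=> [disj cov].
have [owner ownerP] : exists owner : 'I_n -> cvert M,
    forall x, x \in vars_of (owner x).
  apply: (fin_all_exists (P := fun x (h : cvert M) => x \in vars_of h)) => x.
  have : x \in \bigcup_h vars_of (G := M) h by rewrite cov inE.
  by case/bigcupP => h _ xh; exists h.
exists owner => x h; apply/idP/eqP => [xh|<- //].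
apply/eqP; apply/negPn/negP => /disj /disjointFr /(_ (ownerP x)).
by rewrite xh.
Qed.

(** * The label cost of a non-expanding subgraph *)

Section DenseSubgraph.
Variables (R : realType) (Omega : finType) (n k t m : nat).
Variables (mu : 'I_m -> fdist R (k.-tuple Omega))
  (mu_uniform : forall i, wise_uniform t.-1 (mu i)).
Variables (M : factor_graph R Omega n) (owner : 'I_n -> cvert M).
Variables (w : {ffun 'I_m -> scope_tuple k n}).
Hypothesis ownerP : forall x h, (x \in vars_of h) = (owner x == h).

Let G := fg_union (outcome_graph mu_uniform w) M.

Lemma big_cvert_split (H : {set cvert G}) (F : cvert G -> nat) :
  (\sum_(h in H) F h = \sum_(i in [set i | inl i \in H]) F (inl i)
     + \sum_(h in [set h | inr h \in H]) F (inr h))%N.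
Proof. by rewrite big_sumType /=; congr addn; apply: eq_bigl => h; rewrite inE. Qed.

Definition marked_slots (J : {set 'I_m}) (K : {set cvert M}) :
  seq (bool * 'I_n) := [seq (owner x \in K, x) | x <- slots w J].

(** A constraint of [K] occurs as a label only if it owns a slot of [J]; this is how the other
    constraints of [K] get discarded. *)
Lemma label_cost_marked (J : {set 'I_m}) (K : {set cvert M}) :
  label_cost (vertex_label owner) (@half_cost _ _ _ M) (marked_slots J K) =
  (2 * #|[set x in slots w J | owner x \notin K]|
   + \sum_(h in [set owner x | x in slots w J] :&: K) uparam M h)%N.
Proof.
rewrite /label_cost big_uniq ?undup_uniq //= big_sumType /=; congr addn.
  rewrite sum_nat_const mulnC; congr muln; apply: eq_card => x.
  rewrite [LHS](mem_undup _ (inl x)) inE; apply/mapP/andP.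
    move=> [[b y] /mapP[z zs [-> ->]]] /=; rewrite /vertex_label /=.
    by case: ifP => // zK [->]; rewrite zs zK.
  move=> [xs xK]; exists (false, x); rewrite // -(negbTE xK).
  by apply/mapP; exists x.
apply: eq_bigl => h; rewrite inE [LHS](mem_undup _ (inr h)); apply/mapP/andP.
  move=> [[b y] /mapP[z zs [-> ->]]] /=; rewrite /vertex_label /=.
  by case: ifP => // zK [->]; split=> //; apply: imset_f.
move=> [/imsetP[x xs ->] xK]; exists (true, x); rewrite // -xK.
by apply/mapP; exists x.
Qed.

(** The nonrandom scopes are disjoint, so those in [H] contribute their full arities; the slot
    vertices owned outside [H] are disjoint from them. *)
Lemma v_count_ge (H : {set cvert G}) :
  (#|[set x in slots w [set i | inl i \in H] | inr (owner x) \notin H]|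
    + \sum_(h in [set h | inr h \in H]) arity M h <= v_count H)%N.
Proof.
set K := [set h | inr h \in H].
have <- : #|[set x | owner x \in K]| = (\sum_(h in K) arity M h)%N.
  rewrite -sum1_card (partition_big owner (fun h => h \in K)) => [|x]; last by rewrite in_set.
  apply: eq_bigr => h hK; rewrite -card_vars_of -sum1_card.
  apply: eq_bigl => x; rewrite [RHS]ownerP in_set.
  by case: eqP => [->|]; rewrite ?hK ?andbF.
rewrite -cardsUI [X in (_ + X)%N]eq_card0 ?addn0; last first.
  by move=> x; rewrite !inE -andbA andNb andbF.
apply: subset_leq_card; apply/subsetP => x; rewrite !inE => /orP[/andP[xs _]|xK].
  move: xs => /flatten_mapP[i]; rewrite mem_enum inE => iH xi.
  by apply/bigcupP; exists (inl i); rewrite // inE.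
have : x \in vars_of (owner x) by rewrite ownerP.
by rewrite inE => xo; apply/bigcupP; exists (inr (owner x)); rewrite // inE.
Qed.

Lemma nonexpanding_label_cost (zeta small : R) :
  (forall h, 0 < uparam M h)%N -> 0 <= zeta <= 1 / 2 ->
  ~~ expansion G zeta small ->
  exists J K, [/\ J != set0, #|J|%:R <= small &
    (label_cost (vertex_label owner) (@half_cost _ _ _ M)
       (marked_slots J K))%:R
    <= (2 * k%:R - t%:R + 2 * (k.+1%:R * zeta)) * #|J|%:R].
Proof.
move=> up0 /andP[z0 z1].
rewrite negb_forall => /existsP[H]; rewrite !negb_imply -ltNge.
move=> /and3P[_ leH]; set J := [set i | inl i \in H].
set K := [set h | inr h \in H] => ltH.
set u := #|[set x in slots w J | owner x \notin K]|.
have uE : u = #|[set x in slots w J | inr (owner x) \notin H]|.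
  by apply: eq_card => x; rewrite !inE.
set K' := [set owner x | x in slots w J] :&: K.
have cH : c_count H = (#|J| + #|K|)%N.
  by rewrite /c_count -sum1_card big_cvert_split !sum1_card.
have eH : e_count H = (#|J| * k + \sum_(h in K) arity M h)%N.
  by rewrite e_countE big_cvert_split /= sum_nat_const.
have tH : T_total H = (#|J| * t + \sum_(h in K) uparam M h)%N.
  by rewrite /T_total big_cvert_split /= sum_nat_const.
have vH := v_count_ge H; rewrite -/J -/K -uE in vH.
have K'K : K' \subset K by apply: subsetIr.
have cK' : (#|K'| <= #|J| * k)%N.
  apply: leq_trans (subset_leq_card (subsetIl _ _)) _.
  rewrite -(size_slots w); apply: leq_trans (leq_imset_card _ _) _.
  exact: card_size.
(* Discarding a constraint removes [t_h / 2 - zeta], which is nonnegative since [t_h >= 1] and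
   [zeta <= 1/2]. *)
have gain : (\sum_(h in K') uparam M h)%:R / 2 - zeta * #|K'|%:R
    <= (\sum_(h in K) uparam M h)%:R / 2 - zeta * #|K|%:R :> R.
  have E (A : {set cvert M}) : (\sum_(h in A) uparam M h)%:R / 2
      - zeta * #|A|%:R = \sum_(h in A) ((uparam M h)%:R / 2 - zeta).
    by rewrite sumrB -mulr_suml -natr_sum sumr_const mulr_natr.
  rewrite !E [leRHS](big_setID K') /= (setIidPr K'K) lerDl.
  apply: sumr_ge0 => h _; have : 1 <= (uparam M h)%:R :> R by rewrite ler1n.
  by lra.
(* The arities of [K] cancel between [vH] and the failed expansion. [gain] passes from [K] to [K'],
   and [cK'] adds [k zeta] per random constraint; all is doubled for half units. *)
have ltc : (label_cost (vertex_label owner) (@half_cost _ _ _ M)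
       (marked_slots J K))%:R
    < (2 * k%:R - t%:R + 2 * (k.+1%:R * zeta)) * #|J|%:R.
  rewrite label_cost_marked -/u -/K' natrD natrM.
  move: ltH; rewrite cH eH tH !(natrD _ _ _, natrM _ _ _).
  move: vH; rewrite -(ler_nat R) natrD => vH.
  have cK'R : zeta * #|K'|%:R <= zeta * (#|J|%:R * k%:R).
    by rewrite ler_wpM2l // -natrM ler_nat.
  by rewrite -[k.+1]addn1 natrD; lra.
exists J, K; split; last exact: ltW.
  (* For empty [J] the strict bound would put a natural number below 0. *)
  apply: contraTneq ltc => J0; rewrite -leNgt.
  by rewrite J0 cards0 mulr0.
by apply: le_trans leH; rewrite cH ler_nat leq_addr.
Qed.

End DenseSubgraph.

(** * Probability of a low cost for one set of random constraints *)

Lemma prob_scopesE (R : realType) (n k m : nat)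
    (E : pred {ffun 'I_m -> scope_tuple k n}) :
  prob_scopes R E = #|E|%:R * (#|scope_tuple k n|%:R^-1) ^+ m.
Proof.
rewrite /prob_scopes; under eq_bigr do rewrite prodr_const card_ord.
by rewrite sumr_const mulr_natl.
Qed.

(* An outcome is determined by its slots in J and its values outside J. *)
Lemma card_slots_event (n k m : nat) (J : {set 'I_m}) (P : pred (seq 'I_n)) :
  (k <= n)%N ->
  (#|[set w : {ffun 'I_m -> scope_tuple k n} | P (slots w J)]|
    <= #|[set s : (#|J| * k).-tuple 'I_n | P s]|
       * #|scope_tuple k n| ^ #|~: J|)%N.
Proof.
move=> kn.
(* [y0] is a filler on [J]: it turns the values outside [J] into functions supported on the
   complement. *)
have /card_gt0P[y0 _] : (0 < #|scope_tuple k n|)%N.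
  by rewrite card_scope_tuple ffact_gt0.
pose f (w : {ffun 'I_m -> scope_tuple k n}) :=
  (Tuple (introT eqP (size_slots w J)), [ffun i => if i \in J then y0 else w i]).
have inj_f : injective f.
  move=> w w' [eq_s /ffunP eq_out]; apply/ffunP => i.
  case: (boolP (i \in J)) => iJ; last first.
    by move: (eq_out i); rewrite !ffunE (negbTE iJ).
  apply/val_inj/val_inj.
  (* All blocks have length [k], so the flattened sequence determines them. *)
  have /eq_in_map -> // : [seq val (val (w i)) | i <- enum J]
      = [seq val (val (w' i)) | i <- enum J].
    apply: eq_from_flatten_shape => //.
    rewrite /shape -!map_comp; apply: eq_map => i' /=.
    by rewrite !size_tuple.
  by rewrite mem_enum.
rewrite -(card_imset _ inj_f) -(card_pffun_on y0 (mem (~: J)) predT).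
rewrite -[#|pffun_on _ _ _|]cardsE -cardsX.
apply: subset_leq_card; apply/subsetP => _ /imsetP[w wP ->].
rewrite inE in wP; rewrite !inE /= wP; apply/pffun_onP; split => //.
apply/supportP => i; rewrite inE ffunE negbK.
by move->.
Qed.

(** A vertex label comes from its unmarked vertex only, a constraint label from the marked vertices
    of its scope. *)
Lemma card_fiber_vertex_label (R : realType) (Omega : finType) (n A : nat)
    (M : factor_graph R Omega n) (owner : 'I_n -> cvert M) :
  (forall x h, (x \in vars_of h) = (owner x == h)) ->
  (forall h, arity M h <= A)%N -> (0 < A)%N ->
  forall l, (#|[pred p | vertex_label owner p == l]| <= A)%N.
Proof.
move=> ownerP leA A0 [x|h].
  apply: leq_trans A0; rewrite -(card1 (false, x)); apply: subset_leq_card.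
  by apply/subsetP => -[[] y]; rewrite !inE /vertex_label //= => /eqP[->].
apply: leq_trans (leA h); rewrite -card_vars_of.
apply: leq_trans (leq_imset_card (pair true) _).
apply: subset_leq_card; apply/subsetP => -[[] x]; rewrite !inE // => /eqP[xh].
by apply: imset_f; rewrite ownerP xh.
Qed.

Section FixedConstraints.
Variables (R : realType) (Omega : finType) (n : nat).
Variables (M1 M2 : factor_graph R Omega n).
Hypothesis M1P : forall h, arity M1 h = 1%N /\ uparam M1 h = 1%N.
Hypothesis M2P : forall h, uparam M2 h = 2%N.
Let M := fg_union M1 M2.
Variable owner : 'I_n -> cvert M.
Hypothesis ownerP : forall x h, (x \in vars_of h) = (owner x == h).

(** Unmarked vertices give [n r^2]. A marked vertex gives [r^2] if its owner is in [M2], and [r] if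
    it is in [M1], where each constraint owns a single vertex. *)
Lemma sum_half_cost (r : R) : 0 <= r ->
  \sum_p r ^+ @half_cost _ _ _ M (vertex_label owner p)
    <= 2 * n%:R * r ^+ 2 + #|cvert M1|%:R * r.
Proof.
move=> r0.
rewrite -(pair_bigA _ (fun b x =>
  r ^+ @half_cost _ _ _ M (vertex_label owner (b, x)))) /= big_bool /=.
rewrite sumr_const card_ord -[_ *+ n]mulr_natl.
suff : \sum_x r ^+ uparam M (owner x) <= n%:R * r ^+ 2 + #|cvert M1|%:R * r.
  by rewrite /vertex_label /=; lra.
(* Spreading the count of [M1] over the vertices allows a comparison vertex by vertex. *)
have -> : #|cvert M1|%:R = \sum_x \sum_(h : cvert M1) (owner x == inl h)%:R :> R.
  rewrite exchange_big /= -sumr_const; apply: eq_bigr => h _.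
  rewrite -natr_sum -big_mkcond sum1_card; apply/esym.
  have -> : #|[pred x | owner x == inl h]| = #|vars_of (G := M) (inl h)|.
    by apply: eq_card => x; rewrite [RHS]ownerP.
  by rewrite card_vars_of /= (M1P h).1.
rewrite mulr_suml -[n in n%:R]card_ord mulr_natl -sumr_const -big_split /=.
apply: ler_sum => x _; case: (owner x) => h /=.
  rewrite (M1P h).2 expr1 (bigD1 h) //= eqxx mulrDl mul1r.
  rewrite addrCA lerDl addr_ge0 ?exprn_ge0 ?mulr_ge0 //.
  by apply: sumr_ge0.
rewrite M2P lerDl mulr_ge0 //; exact: sumr_ge0.
Qed.

End FixedConstraints.

(** Counting marked sequences absorbs the choice of [K], so no union bound over [K] is paid. *)
Lemma prob_low_cost (R : realType) (Omega : finType) (n k m A : nat)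
    (M : factor_graph R Omega n) (owner : 'I_n -> cvert M)
    (J : {set 'I_m}) (r x : R) :
  (k <= n)%N -> 0 < r <= 1 ->
  (forall l, #|[pred p | vertex_label owner p == l]| <= A)%N ->
  prob_scopes R (fun w : {ffun 'I_m -> scope_tuple k n} =>
      [exists K, (label_cost (vertex_label owner) (@half_cost _ _ _ M)
         (marked_slots owner w J K))%:R <= x]) * r `^ x
  <= ((A * (#|J| * k))%:R
      + \sum_p r ^+ @half_cost _ _ _ M (vertex_label owner p)) ^+ (#|J| * k)
     * (#|scope_tuple k n|%:R^-1) ^+ #|J|.
Proof.
move=> kn r01 fib.
pose N := (#|J| * k)%N.
pose lowc := [set s : N.-tuple (bool * 'I_n) |
  (label_cost (vertex_label owner) (@half_cost _ _ _ M) s)%:R <= x].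
pose P (s : seq 'I_n) := [exists K : {set cvert M},
  (label_cost (vertex_label owner) (@half_cost _ _ _ M)
    [seq (owner y \in K, y) | y <- s])%:R <= x].
have S0 : 0 < #|scope_tuple k n|%:R :> R.
  by rewrite ltr0n card_scope_tuple ffact_gt0.
(* Erasing the marks maps the low-cost marked sequences onto a set containing every slot sequence
   that is cheap for some [K]. *)
have leP : (#|[set s : N.-tuple 'I_n | P s]| <= #|lowc|)%N.
  apply: leq_trans (leq_imset_card (map_tuple snd) _).
  apply: subset_leq_card; apply/subsetP => s; rewrite inE => /existsP[K leK].
  apply/imsetP; exists (map_tuple (fun y => (owner y \in K, y)) s).
    by rewrite inE.
  by apply: val_inj; rewrite /= -map_comp map_id.
have leE := card_slots_event J P kn.
have := leq_trans leE (leq_mul leP (leqnn _)).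
rewrite -(ler_nat R) natrM natrX => le.
rewrite prob_scopesE.
apply: le_trans (_ : #|lowc|%:R * (#|scope_tuple k n|%:R^-1) ^+ #|J| * r `^ x <= _).
  rewrite ler_wpM2r ?powR_ge0 //.
  have mE : (#|~: J| + #|J| = m)%N by rewrite addnC cardsC card_ord.
  have -> : #|scope_tuple k n|%:R^-1 ^+ m = #|scope_tuple k n|%:R^-1 ^+ #|~: J|
      * #|scope_tuple k n|%:R^-1 ^+ #|J| :> R by rewrite -exprD mE.
  rewrite mulrA ler_wpM2r ?exprn_ge0 ?invr_ge0 ?ler0n //.
  by rewrite exprVn ler_pdivrMr ?exprn_gt0 // -[X in X%:R <= _]cardsE.
rewrite mulrAC ler_wpM2r ?exprn_ge0 ?invr_ge0 ?ler0n //.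
exact: card_low_cost.
Qed.

(** * The union bound over sets of random constraints *)

Lemma prob_scopes_union (R : realType) (n k m : nat) (I : finType)
    (Q : pred I) (E : pred {ffun 'I_m -> scope_tuple k n})
    (F : I -> pred {ffun 'I_m -> scope_tuple k n}) :
  (forall w, E w -> exists2 i, Q i & F i w) ->
  prob_scopes R E <= \sum_(i | Q i) prob_scopes R (F i).
Proof.
move=> EF; rewrite /prob_scopes.
have c0 : 0 <= \prod_(i < m) #|scope_tuple k n|%:R^-1 :> R.
  by apply: prodr_ge0 => i _; rewrite invr_ge0.
rewrite (exchange_big_dep xpredT) //= [leRHS](bigID E) /=.
apply: ler_wpDr; first by do 2![apply: sumr_ge0 => ? _].
apply: ler_sum => w /EF[i Qi Fiw].
by rewrite (bigD1 i) ?Qi //= lerDl sumr_ge0.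
Qed.

Lemma sum_sets_le (R : realType) (m : nat) (small y : R) (F : nat -> R) :
  0 <= y <= 1 / 2 -> (forall j, 0 <= F j) ->
  (forall j, (0 < j)%N -> j%:R <= small -> 'C(m, j)%:R * F j <= y ^+ j) ->
  \sum_(J : {set 'I_m} | (J != set0) && (#|J|%:R <= small)) F #|J| <= 2 * y.
Proof.
move=> y01 F0 leF; apply: le_trans (sum_geometric_le m y01).
have cardJ (J : {set 'I_m}) : (#|J| < m.+1)%N.
  by rewrite ltnS -[m in (_ <= m)%N]card_ord max_card.
(* A one-term sum over the size [j] prepares the exchange that groups the sets by size; nonemptiness
   lets [j] start at 1. *)
under eq_bigr => J /andP[J0 _].
  have <- : \sum_(1 <= j < m.+1 | j == #|J|) F j = F #|J|.
    by rewrite big_nat1_eq card_gt0 J0 cardJ.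
over.
rewrite (exchange_big_dep xpredT) //= !big_nat.
apply: ler_sum => j /andP[j0 _].
rewrite sumr_const -mulr_natl.
have [js|sj] := lerP j%:R small; last first.
  rewrite [X in X%:R](_ : _ = 0%N) ?mul0r ?exprn_ge0 //; first by case/andP: y01.
  apply: eq_card0 => J; rewrite inE; apply/negP => /andP[/andP[_ Js] /eqP jJ].
  by move: sj; rewrite jJ ltNge Js.
apply: le_trans (leF j j0 js); rewrite ler_wpM2r // ler_nat.
rewrite -[m in 'C(m, _)]card_ord -card_draws; apply: subset_leq_card.
by apply/subsetP => J; rewrite !inE eq_sym => /andP[].
Qed.

(** * The explicit bound for one set *)

(** With [q = r^2] the exponents of [r] add up to [2 j k]. This trades the weight of the cost
    threshold for [(q q^E)^j]. *)
Lemma powR_sqrt_exponent (R : realType) (q E : R) (k j : nat) : 0 < q ->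
  Num.sqrt q `^ ((2 * k%:R - 2 - 2 * E) * j%:R) * (q * q `^ E) ^+ j
    = q ^+ (j * k).
Proof.
move=> q0; set r := Num.sqrt q.
have r0 : 0 < r by rewrite sqrtr_gt0.
have rn x y : r `^ (x + y) = r `^ x * r `^ y.
  by apply: powRD; apply/implyP => _; rewrite gt_eqF.
have qE : q = r `^ 2 by rewrite powR_mulrn ?ltW // sqr_sqrtr // ltW.
have -> : q * q `^ E = r `^ (2 + 2 * E) by rewrite rn powRrM -qE.
rewrite -powR_mulrn ?powR_ge0 // -powRrM -rn.
have -> : (2 * k%:R - 2 - 2 * E) * j%:R + (2 + 2 * E) * j%:R
  = 2 * (j * k)%:R by rewrite natrM; ring.
by rewrite powRrM -qE powR_mulrn // ltW.
Qed.

(** The weight is [sqrt q] because costs are in half units. The bounds [(D j)^(j k)] and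
    [(k^k / n^k)^j] combine to [(D^k k^k)^j q^(j k)], and dividing by the threshold weight leaves
    [q q^E]. *)
Lemma prob_low_cost_le (R : realType) (Omega : finType) (n k m A : nat)
    (M : factor_graph R Omega n) (owner : 'I_n -> cvert M)
    (J : {set 'I_m}) (D E : R) :
  (k <= n)%N -> (0 < #|J| <= n)%N ->
  (forall l, #|[pred p | vertex_label owner p == l]| <= A)%N ->
  let q := #|J|%:R / n%:R in
  (A * (#|J| * k))%:R
    + \sum_p Num.sqrt q ^+ @half_cost _ _ _ M (vertex_label owner p)
    <= D * #|J|%:R ->
  prob_scopes R (fun w : {ffun 'I_m -> scope_tuple k n} =>
      [exists K, (label_cost (vertex_label owner) (@half_cost _ _ _ M)
         (marked_slots owner w J K))%:R
       <= (2 * k%:R - 2 - 2 * E) * #|J|%:R])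
  <= (D ^+ k * (k ^ k)%:R * (q * q `^ E)) ^+ #|J|.
Proof.
move=> kn /andP[j0 jn] fib q leD.
have n0 : 0 < n%:R :> R by rewrite ltr0n (leq_trans j0).
have q0 : 0 < q by rewrite divr_gt0 // ltr0n.
have r01 : 0 < Num.sqrt q <= 1.
  by rewrite sqrtr_gt0 q0 -[X in _ <= X]sqrtr1 ler_wsqrtr // ler_pdivrMr // mul1r ler_nat.
have := prob_low_cost J ((2 * k%:R - 2 - 2 * E) * #|J|%:R) kn r01 fib.
set P := prob_scopes _ _ => leP.
set V := \sum_p _ in leD leP.
have V0 : 0 <= V by apply: sumr_ge0 => p _; rewrite exprn_ge0 // sqrtr_ge0.
have Sinv : #|scope_tuple k n|%:R^-1 <= (k ^ k)%:R / n%:R ^+ k :> R.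
  rewrite card_scope_tuple ler_pdivlMr ?exprn_gt0 // mulrC.
  rewrite ler_pdivrMr ?ltr0n ?ffact_gt0 // -natrX -natrM ler_nat.
  exact: expn_le_ffact.
rewrite -(ler_pM2r (exprn_gt0 (#|J| * k) q0)) -[X in P * X](powR_sqrt_exponent E k #|J| q0).
rewrite mulrA; set z := q * q `^ E.
have z0 : 0 <= z by rewrite mulr_ge0 ?powR_ge0 ?ltW.
have -> : (D ^+ k * (k ^ k)%:R * z) ^+ #|J| * q ^+ (#|J| * k)
  = (D * #|J|%:R) ^+ (#|J| * k) * ((k ^ k)%:R / n%:R ^+ k) ^+ #|J| * z ^+ #|J|.
  rewrite !(mulnC #|J|) !exprM -!exprMn; congr (_ ^+ _).
  by rewrite /q !exprMn exprVn; ring.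
rewrite ler_wpM2r ?exprn_ge0 //; apply: le_trans leP _.
apply: ler_pM; rewrite ?exprn_ge0 ?addr_ge0 ?invr_ge0 ?ler0n //.
  by rewrite lerXn2r // nnegrE ?(le_trans _ leD) // addr_ge0.
by rewrite lerXn2r // nnegrE ?invr_ge0 // divr_ge0 // exprn_ge0.
Qed.

(** * Choice of constants and conclusion *)

Theorem theorem5 (R : realType)
    (* the constants hidden in t <= O(1), k <= O(1), U = O(sqrt n) and
       "constant arity" *)
    (t0 k0 a0 : nat) (CU : R) :
  exists2 c : R, 0 < c &
  forall (t k n : nat) (U p zeta small Delta : R),
    (3 <= t <= t0)%N ->
    (k <= k0)%N ->
    (k <= n)%N ->
    U <= CU * Num.sqrt n%:R ->
    0 < p < 1 / 2 ->
    0 < zeta <= 1 / 2 ->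
    1 <= small <= n%:R ->
  let zeta' := k.+1%:R * zeta in
    zeta' <= t%:R / 2 - 1 ->
  forall (Omega : finType)
    (m : nat) (mu : 'I_m -> fdist R (k.-tuple Omega))
    (mu_uniform : forall i, wise_uniform t.-1 (mu i))
    (M1 M2 : factor_graph R Omega n),
    m%:R = Delta * n%:R ->
    partitions_vars (fg_union M1 M2) ->
    (forall h, arity M1 h = 1%N /\ uparam M1 h = 1%N) ->
    #|cvert M1|%:R <= U ->
    (forall h, (arity M2 h <= a0)%N /\ uparam M2 h = 2%N) ->
    Delta <= c * p * (n%:R / small) `^ (t%:R / 2 - 1 - zeta') ->
  prob_scopes R (fun w : {ffun 'I_m -> scope_tuple k n} =>
    ~~ expansion
         (fg_union (outcome_graph mu_uniform w) (fg_union M1 M2)) zeta small)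
  <= p.
Proof.
(* The summands of [D] pay for repeated labels, for the two [n q] terms and for [M1]; [B] bounds
   [k^k]. *)
pose D : R := (a0.+1 * k0)%:R + 2 + `|CU|.
pose B : R := (k0.+1 ^ k0)%:R.
have D1 : 1 <= D by rewrite /D; have := normr_ge0 CU; have := ler0n R (a0.+1 * k0); lra.
have D0 : 0 <= D := le_trans ler01 D1.
have B0 : 0 < B by rewrite ltr0n expn_gt0.
have C0 : 0 < expR 1 * D ^+ k0 * B.
  by rewrite !mulr_gt0 ?expR_gt0 ?exprn_gt0 // (lt_le_trans ltr01).
(* This [c] makes the ratio of the geometric series at most [p / 2]. *)
exists (2 * (expR 1 * D ^+ k0 * B))^-1; first by rewrite invr_gt0 mulr_gt0.
move=> t k n U p zeta small Delta _ kk0 kn leU /andP[p0 p1] /andP[z0 z1].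
move=> /andP[s1 sn] zeta' leE Omega m mu mu_uniform M1 M2 mE part M1P cardM1 M2P.
set E := t%:R / 2 - 1 - zeta' => leDelta.
have E0 : 0 <= E by rewrite subr_ge0.
have n0 : 0 < n%:R :> R by apply: lt_le_trans (le_trans s1 sn).
have s0 : 0 < small by apply: lt_le_trans s1.
pose M := fg_union M1 M2.
have [owner ownerP] := owner_exists part.
(* The successor covers the unary constraints of [M1] even when [a0 = 0]. *)
have fib : forall l, (#|[pred p | vertex_label owner p == l]| <= a0.+1)%N.
  apply: card_fiber_vertex_label => // -[] h /=; first by rewrite (M1P h).1.
  by apply: leq_trans (M2P h).1 _.
have up0 (h : cvert M) : (0 < uparam M h)%N.
  by case: h => h /=; rewrite ?(M1P h).2 ?(M2P h).2.
pose F (J : {set 'I_m}) (w : {ffun 'I_m -> scope_tuple k n}) :=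
  [exists K, (label_cost (vertex_label owner) (@half_cost _ _ _ M)
     (marked_slots owner w J K))%:R <= (2 * k%:R - 2 - 2 * E) * #|J|%:R].
pose Q (J : {set 'I_m}) := (J != set0) && (#|J|%:R <= small).
apply: le_trans (@prob_scopes_union R n k m _ Q _ F _) _.
  move=> w bad.
  have [|J [K [J0 Js lec]]] := nonexpanding_label_cost ownerP up0 _ bad.
    by rewrite ltW.
  exists J; first by rewrite /Q J0.
  apply/existsP; exists K; apply: le_trans lec _.
  by rewrite ler_wpM2r // /E /zeta'; lra.
pose q (j : nat) : R := j%:R / n%:R.
pose b (j : nat) := D ^+ k * (k ^ k)%:R * (q j * q j `^ E).
have b0 j : 0 <= b j.
  by rewrite !mulr_ge0 ?exprn_ge0 ?powR_ge0 ?invr_ge0 //.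
have leF J : Q J -> prob_scopes R (F J) <= b #|J| ^+ #|J|.
  move=> /andP[J0 Js]; rewrite -card_gt0 in J0.
  have jn : (#|J| <= n)%N by rewrite -(ler_nat R) (le_trans Js).
  apply: prob_low_cost_le; rewrite ?J0 //.
  have j1 : 1 <= #|J|%:R :> R by rewrite ler1n.
  set r := Num.sqrt _; have r0 : 0 <= r by apply: sqrtr_ge0.
  have := sum_half_cost M1P (fun h => (M2P h).2) ownerP r0.
  have -> : 2 * n%:R * r ^+ 2 = 2 * #|J|%:R.
    by rewrite sqr_sqrtr ?divr_ge0 // -mulrA [n%:R * _]mulrC divfK // gt_eqF.
  (* The [sqrt n] in the bound on [U] cancels against [sqrt (j / n)], leaving [sqrt j <= j], where
     [j] is the size of [J]. *)
  have leUr : #|cvert M1|%:R * r <= `|CU| * #|J|%:R.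
    apply: le_trans (_ : `|CU| * (Num.sqrt n%:R * r) <= _).
      rewrite mulrA ler_wpM2r // (le_trans cardM1) // (le_trans leU) //.
      by rewrite ler_wpM2r ?sqrtr_ge0 // ler_norm.
    rewrite -sqrtrM // [n%:R * _]mulrC divfK ?gt_eqF // ler_wpM2l //.
    rewrite -[leRHS]ger0_norm // -sqrtr_sqr ler_wsqrtr // expr2.
    by rewrite ler_peMl.
  have leA : (a0.+1 * (#|J| * k))%:R <= (a0.+1 * k0)%:R * #|J|%:R :> R.
    by rewrite -natrM ler_nat mulnCA mulnC leq_mul2r leq_mul2l kk0 !orbT.
  by rewrite /D; lra.
apply: le_trans (ler_sum _ leF) _.
have -> : p = 2 * (p / 2) by field.
apply: (@sum_sets_le R m small (p / 2) (fun j => b j ^+ j)).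
- by lra.
- by move=> j; rewrite exprn_ge0.
move=> j j0 js.
have j0R : 0 < j%:R :> R by rewrite ltr0n.
(* The extracted [j] supplies the [j^j] that [bin_mul_le] absorbs; the remaining [1 / n] turns [m]
   into [Delta]. *)
have -> : b j = j%:R * (D ^+ k * (k ^ k)%:R * q j `^ E / n%:R).
  by rewrite /b {1}/q; ring.
rewrite exprMn mulrA.
have b'0 : 0 <= D ^+ k * (k ^ k)%:R * q j `^ E / n%:R.
  by rewrite !mulr_ge0 ?exprn_ge0 ?powR_ge0 ?invr_ge0 //.
apply: le_trans (ler_wpM2r _ (bin_mul_le R m j)) _; first by rewrite exprn_ge0.
rewrite -exprMn; apply: lerXn2r; rewrite ?nnegrE.
- by apply: mulr_ge0 => //; rewrite mulr_ge0 ?expR_ge0.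
- by lra.
(* The product of [n / small] and [q j] is [j / small <= 1], so its power [E >= 0] is at most 1. *)
have lep : Delta * q j `^ E <= (2 * (expR 1 * D ^+ k0 * B))^-1 * p.
  apply: le_trans (ler_wpM2r (powR_ge0 _ _) leDelta) _.
  rewrite -[leLHS]mulrA; apply: ler_piMr.
    by rewrite mulr_ge0 ?invr_ge0 ?(ltW p0) ?(ltW (mulr_gt0 _ C0)).
  rewrite -powRM ?divr_ge0 ?(ltW s0) //.
  have -> : n%:R / small * q j = j%:R / small.
    by rewrite /q; field; rewrite !gt_eqF.
  apply: le_trans (_ : 1 `^ E <= 1); last by rewrite powR1.
  apply: ge0_ler_powR => //; rewrite ?nnegrE ?divr_ge0 ?(ltW s0) //.
  by rewrite ler_pdivrMr // mul1r.
have leDB : D ^+ k * (k ^ k)%:R <= D ^+ k0 * B.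
  apply: ler_pM; rewrite ?exprn_ge0 //; first by rewrite ler_weXn2l.
  rewrite ler_nat; apply: leq_trans (_ : k0.+1 ^ k <= _)%N; last by rewrite leq_pexp2l.
  case: (posnP k) => [->|k_gt0]; first by rewrite !expn0.
  by rewrite leq_exp2r // ltnW.
have DB0 : 0 <= D ^+ k0 * B by rewrite mulr_ge0 ?exprn_ge0 ?(ltW B0).
have mE' : m%:R / n%:R = Delta :> R by rewrite mE mulfK // gt_eqF.
have Delta0 : 0 <= Delta by rewrite -mE' divr_ge0.
have -> : expR 1 * m%:R * (D ^+ k * (k ^ k)%:R * q j `^ E / n%:R)
   = expR 1 * (D ^+ k * (k ^ k)%:R) * (Delta * q j `^ E) by rewrite -mE'; ring.
apply: le_trans (_ : expR 1 * (D ^+ k0 * B) *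
    ((2 * (expR 1 * D ^+ k0 * B))^-1 * p) <= _).
  apply: ler_pM => //; rewrite ?mulr_ge0 ?expR_ge0 ?powR_ge0 ?exprn_ge0 //.
  by rewrite ler_wpM2l ?expR_ge0.
rewrite le_eqVlt; apply/orP; left; apply/eqP; field.
by rewrite !gt_eqF ?expR_gt0 ?exprn_gt0 // (lt_le_trans ltr01).
Qed.
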